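(* Let $(\alpha,\beta,u,v,x)$ be a GSVD component of $(A,B)$ with generalized singular value $\sigma=\alpha/\beta$ that is simple, and let $(\sigma,y)$ and $(\frac1\sigma,z)$ be the corresponding eigenpairs of $(\widehat A,\widehat B)$ and $(\widetilde B,\widetilde A)$. Assume that their approximations $(\widehat\sigma,\widehat y)$ and $(\frac{1}{\widetilde\sigma},\widetilde z)$ are eigenpairs of the perturbed pairs $(\widehat A+\widehat E,\widehat B+\widehat F)$ and $(\widetilde B+\widetilde F,\widetilde A+\widetilde E)$, respectively, where the perturbations satisfy $$\max\{\|\widehat E\|,\|\widehat F\|,\|\widetilde E\|,\|\widetilde F\|\}\le\max\{\|A\|^2,\|B\|^2,1\}\,\epsilon .$$ If $\epsilon$ is sufficiently small, then $$\chi(\widehat\sigma,\sigma)\le\frac{(\|x\|^2+\beta^2)(1+\delta_1)}{2\beta}\sqrt{\|\widehat E\|^2+\|\widehat F\|^2},$$ $$\chi(\widetilde\sigma,\sigma)\le\frac{(\|x\|^2+\alpha^2)(1+\delta_2)}{2\alpha}\sqrt{\|\widetilde E\|^2+\|\widetilde F\|^2},$$ where $\delta_1=\mathcal{O}(\epsilon)$ and $\delta_2=\mathcal{O}(\epsilon)$.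
   Context: $\|\cdot\|$ is the 2-norm. $A\in\mathbb{R}^{m\times n}$ ($m\ge n$) and $B\in\mathbb{R}^{p\times n}$ ($p\ge n$) have full column rank $n$. The GSVD of $(A,B)$ is $A=UCX^{-1}$, $B=VSX^{-1}$ with $C=\mathrm{diag}\{\alpha_1,\dots,\alpha_n\}$, $S=\mathrm{diag}\{\beta_1,\dots,\beta_n\}$, $\alpha_i,\beta_i>0$, $\alpha_i^2+\beta_i^2=1$, $X=[x_1,\dots,x_n]$ nonsingular, and $U=[u_1,\dots,u_n]$, $V=[v_1,\dots,v_n]$ with orthonormal columns. Each $(\alpha_i,\beta_i,u_i,v_i,x_i)$ is a GSVD component with generalized singular value $\sigma_i=\alpha_i/\beta_i$; a generic one is written $(\alpha,\beta,u,v,x)$. Define $$\widehat A=\begin{bmatrix}0&A\\ A^T&0\end{bmatrix},\ \widehat B=\begin{bmatrix}I_m&0\\ 0&B^TB\end{bmatrix},\qquad \widetilde B=\begin{bmatrix}0&B\\ B^T&0\end{bmatrix},\ \widetilde A=\begin{bmatrix}I_p&0\\ 0&A^TA\end{bmatrix}.$$ $(\mu,w)$ is an eigenpair of $(M,N)$ if $Mw=\mu Nw$, $w\neq0$. The eigenvectors corresponding to the GSVD component are $y=\frac{1}{\sqrt2}\begin{bmatrix}u\\ x/\beta\end{bmatrix}$ (for $(\widehat A,\widehat B)$, eigenvalue $\sigma$) and $z=\frac1{\sqrt2}\begin{bmatrix}v\\ x/\alpha\end{bmatrix}$ (for $(\widetilde B,\widetilde A)$, eigenvalue $1/\sigma$).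 The chordal distance is $\chi(a,b)=\frac{|a-b|}{\sqrt{1+a^2}\sqrt{1+b^2}}$. Here $A,B$ and the GSVD component are fixed, ''approximations'' means that $\widehat\sigma$ (resp. $1/\widetilde\sigma$) is the eigenvalue of the perturbed pair that converges to $\sigma$ (resp. $1/\sigma$) as $\epsilon\to0$, and $\mathcal O(\epsilon)$ is as $\epsilon\to0$ with constants depending only on $A$, $B$ and the component. *)

(* Defs.v *)
From mathcomp Require Import all_boot all_order all_algebra.
From mathcomp Require Import all_classical all_reals all_analysis.
Import Order.TTheory GRing.Theory Num.Theory.
Import numFieldNormedType.Exports.

Set Implicit Arguments.
Unset Strict Implicit.
Unset Printing Implicit Defensive.

Local Open Scope classical_set_scope.
Local Open Scope ring_scope.

(* The library norm `|M| of a matrix is the maximum of the absolute values of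
   its entries, so the 2-norms are defined here. *)
Definition vnorm2 (R : realType) (k : nat) (v : 'cV[R]_k) : R :=
  Num.sqrt (\sum_(i < k) v i 0 ^+ 2).

Definition mxnorm2 (R : realType) (k l : nat) (M : 'M[R]_(k, l)) : R :=
  sup [set vnorm2 (M *m v) | v in [set v : 'cV[R]_l | vnorm2 v <= 1]].

Record is_gsvd (R : realType) (m n p : nat)
    (A : 'M[R]_(m, n)) (B : 'M[R]_(p, n))
    (U : 'M[R]_(m, n)) (V : 'M[R]_(p, n)) (X : 'M[R]_n)
    (alphas betas : 'rV[R]_n) : Prop := {
  gsvd_A : A = U *m diag_mx alphas *m invmx X;
  gsvd_B : B = V *m diag_mx betas *m invmx X;
  gsvd_U : U^T *m U = 1%:M;
  gsvd_V : V^T *m V = 1%:M;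
  gsvd_X : X \in unitmx;
  gsvd_alpha_gt0 : forall i, 0 < alphas 0 i;
  gsvd_beta_gt0 : forall i, 0 < betas 0 i;
  gsvd_unit : forall i, alphas 0 i ^+ 2 + betas 0 i ^+ 2 = 1
}.

Definition gsv (R : realType) (n : nat) (alphas betas : 'rV[R]_n) (i : 'I_n)
    : R := alphas 0 i / betas 0 i.

(* Simplicity is counted with multiplicity: it is about the index i, not about
   the value in the set of generalized singular values. *)
Definition simple_gsv (R : realType) (n : nat) (alphas betas : 'rV[R]_n)
    (i : 'I_n) : Prop :=
  forall j, j != i -> gsv alphas betas j != gsv alphas betas i.

Definition hatA (R : realType) (m n : nat) (A : 'M[R]_(m, n)) : 'M[R]_(m + n) :=
  block_mx 0 A A^T 0.

Definition hatB (R : realType) (m n p : nat) (B : 'M[R]_(p, n))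
    : 'M[R]_(m + n) := block_mx 1%:M 0 0 (B^T *m B).

Definition tildeB (R : realType) (n p : nat) (B : 'M[R]_(p, n))
    : 'M[R]_(p + n) := block_mx 0 B B^T 0.

Definition tildeA (R : realType) (m n p : nat) (A : 'M[R]_(m, n))
    : 'M[R]_(p + n) := block_mx 1%:M 0 0 (A^T *m A).

Arguments hatB {R} m {n p} B.
Arguments tildeA {R m n} p A.

Definition eigenpair (R : realType) (k : nat) (M N : 'M[R]_k)
    (mu : R) (w : 'cV[R]_k) : Prop :=
  M *m w = mu *: (N *m w) /\ w != 0.

Definition chordal (R : realType) (a b : R) : R :=
  `|a - b| / (Num.sqrt (1 + a ^+ 2) * Num.sqrt (1 + b ^+ 2)).

(* Main.v *)
Require Import Defs.
From mathcomp Require Import all_boot all_order all_algebra.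
From mathcomp Require Import all_classical all_reals all_analysis.
From mathcomp Require Import ring lra.
Import Order.TTheory GRing.Theory Num.Theory.
Import numFieldNormedType.Exports.

Set Implicit Arguments.
Unset Strict Implicit.
Unset Printing Implicit Defensive.

Local Open Scope classical_set_scope.
Local Open Scope ring_scope.

(** The pair (hatA A, hatB B) is symmetric and y is an eigenvector of it with
    y^T hatB y = 1, so y^T is also a left eigenvector.  If the perturbed pair
    has the eigenpair (s, w), multiplying its equation by y^T gives
        (s - sigma) y^T hatB w = y^T (E - s F) w,
    and by Cauchy-Schwarz
        |s - sigma| |y^T hatB w|
          <= |y| |w| sqrt (1 + s^2) sqrt (|E|^2 + |F|^2).
    Dividing by sqrt (1 + s^2) sqrt (1 + sigma^2) turns the left side into a
    chordal distance with no first-order loss.  What remains is to compare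
    |w| with |y^T hatB w| |y|, and to compute
    |y|^2 / sqrt (1 + sigma^2) = (|x|^2 + beta^2) / (2 beta).

    The comparison uses simplicity: hatA - sigma hatB, completed by the rank one
    matrix (hatB y)(hatB y)^T, is invertible, so the part of w complementary to
    y is controlled by the residual (hatA - sigma hatB) w
    ([residual_bound]).  That residual is at most
    (|s - sigma| |hatB| + |E| + |s| |F|) |w|.  Since s tends to sigma it is a
    small multiple of |w|, which gives |w| = O(|y^T hatB w|), hence
    |s - sigma| = O(e); so the residual is really O(e) |w|, and
    |w| <= |y^T hatB w| |y| (1 + O(e)) ([chordal_bound]).  The constant in this
    O(e) depends only on the pair, on y and on the bound K on the size of the
    perturbation relative to e; only the threshold below which the
    estimate holds depends on the perturbation.

    The eigenspace of sigma is computed from the decomposition: eliminating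
    the first block leaves A^T A b = sigma^2 B^T B b, which X diagonalises to
    alpha_j^2 t_j = sigma^2 beta_j^2 t_j ([gsvd_eigenvector_simple]).

    The second estimate is the first one for the pair (B, A), whose
    decomposition exchanges U with V and alpha with beta, because tildeB B and
    tildeA A are hatA B and hatB A, and because the chordal distance is
    invariant under inversion of positive numbers. *)

(** * The Euclidean norm and the operator norm *)

Section EuclideanNorm.
Variable R : realType.
Implicit Types k l : nat.

Lemma vnorm2_ge0 k (v : 'cV[R]_k) : 0 <= vnorm2 v.
Proof. exact: sqrtr_ge0. Qed.

Lemma vnorm2_sqr k (v : 'cV[R]_k) : vnorm2 v ^+ 2 = (v^T *m v) 0 0.
Proof.
rewrite sqr_sqrtr; last by apply: sumr_ge0 => j _; exact: sqr_ge0.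
by rewrite mxE; apply: eq_bigr => j _; rewrite mxE expr2.
Qed.

Lemma vnorm2_eq0 k (v : 'cV[R]_k) : (vnorm2 v == 0) = (v == 0).
Proof.
apply/idP/eqP => [/eqP v0|->]; last first.
  by rewrite -sqrf_eq0 vnorm2_sqr mulmx0 mxE.
have /eqP : \sum_(j < k) v j 0 ^+ 2 = 0.
  rewrite -[LHS]sqr_sqrtr; last by apply: sumr_ge0 => j _; exact: sqr_ge0.
  by rewrite -/(vnorm2 v) v0 expr0n.
rewrite psumr_eq0 => [/allP h|j _]; last exact: sqr_ge0.
apply/matrixP => j c; rewrite ord1 mxE.
by apply/eqP; rewrite -sqrf_eq0; apply: h; rewrite mem_index_enum.
Qed.

Lemma vnorm2_0 k : vnorm2 (0 : 'cV[R]_k) = 0.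
Proof. by apply/eqP; rewrite vnorm2_eq0. Qed.

Lemma dotmxZ k (c d : R) (a b : 'cV[R]_k) :
  ((c *: a)^T *m (d *: b)) 0 0 = c * d * (a^T *m b) 0 0.
Proof. by rewrite [_^T]linearZ /= -scalemxAl -scalemxAr !mxE mulrA. Qed.

Lemma vnorm2Z k (c : R) (v : 'cV[R]_k) : vnorm2 (c *: v) = `|c| * vnorm2 v.
Proof.
apply/eqP; rewrite -(@eqrXn2 _ 2) ?mulr_ge0 ?vnorm2_ge0 // exprMn !vnorm2_sqr.
by rewrite real_normK ?num_real // dotmxZ.
Qed.

Lemma dotmxC k (a b : 'cV[R]_k) : (a^T *m b) 0 0 = (b^T *m a) 0 0.
Proof. by rewrite -[a in RHS]trmxK -trmx_mul [RHS]mxE. Qed.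

Lemma vnorm2D_sqr k (a b : 'cV[R]_k) :
  vnorm2 (a + b) ^+ 2 = vnorm2 a ^+ 2 + vnorm2 b ^+ 2 + 2 * (a^T *m b) 0 0.
Proof.
rewrite !vnorm2_sqr [_^T]linearD /= mulmxDl !mulmxDr.
have -> (M N P Q : 'M[R]_1) :
  (M + N + (P + Q)) 0 0 = M 0 0 + N 0 0 + (P 0 0 + Q 0 0) by rewrite !mxE.
by rewrite (dotmxC b a); ring.
Qed.

Lemma dotmx_le k (a b : 'cV[R]_k) :
  `|(a^T *m b) 0 0| <= vnorm2 a * vnorm2 b.
Proof.
have [->|b0] := eqVneq b 0; first by rewrite mulmx0 mxE normr0 vnorm2_0 mulr0.
rewrite -(@ler_pXn2r _ 2) ?nnegrE ?mulr_ge0 ?vnorm2_ge0 //.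
rewrite real_normK ?num_real // exprMn.
have q_gt0 : 0 < vnorm2 b ^+ 2 by rewrite exprn_gt0// lt_def vnorm2_eq0 b0 vnorm2_ge0.
set d := (a^T *m b) 0 0.
(* The vector |b|^2 a - <a, b> b is |b|^2 times the component of a
   orthogonal to b. *)
have := sqr_ge0 (vnorm2 (vnorm2 b ^+ 2 *: a + (- d) *: b)).
rewrite vnorm2D_sqr !vnorm2Z dotmxZ -/d !exprMn !real_normK ?num_real //.
rewrite (_ : _ + _ = vnorm2 b ^+ 2 * (vnorm2 a ^+ 2 * vnorm2 b ^+ 2 - d ^+ 2)).
  by rewrite pmulr_rge0 // subr_ge0.
by ring.
Qed.

Lemma vnorm2D k (a b : 'cV[R]_k) : vnorm2 (a + b) <= vnorm2 a + vnorm2 b.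
Proof.
rewrite -(@ler_pXn2r _ 2) ?nnegrE ?addr_ge0 ?vnorm2_ge0 //.
rewrite vnorm2D_sqr.
have := le_trans (ler_norm _) (dotmx_le a b); nra.
Qed.

Lemma vnorm2N k (a : 'cV[R]_k) : vnorm2 (- a) = vnorm2 a.
Proof. by rewrite -scaleN1r vnorm2Z normrN normr1 mul1r. Qed.

(** Cauchy-Schwarz on each row bounds the image of the unit ball by the
    Frobenius norm.  Without such a bound the supremum defining the operator
    norm would be a default value. *)
Lemma mxnorm2_has_ubound k l (M : 'M[R]_(k, l)) :
  has_ubound [set vnorm2 (M *m v) | v in [set v : 'cV[R]_l | vnorm2 v <= 1]].
Proof.
exists (Num.sqrt (\sum_j vnorm2 (row j M)^T ^+ 2)) => _ [v /= v1 <-].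
apply: ler_wsqrtr; apply: ler_sum => j _.
rewrite -[(M *m v) j 0]/(_ j 0) -real_normK ?num_real //.
rewrite ler_pXn2r ?nnegrE ?vnorm2_ge0 //.
have -> : (M *m v) j 0 = ((row j M)^T^T *m v) 0 0.
  by rewrite trmxK -row_mul [RHS]mxE.
apply: le_trans (dotmx_le _ _) _.
by rewrite -[leRHS]mulr1 ler_wpM2l ?vnorm2_ge0.
Qed.

Lemma mxnorm2_ge0 k l (M : 'M[R]_(k, l)) : 0 <= mxnorm2 M.
Proof.
apply: ub_le_sup; first exact: mxnorm2_has_ubound.
by exists 0; rewrite /= ?mulmx0 vnorm2_0.
Qed.

Lemma vnorm2_mulmx k l (M : 'M[R]_(k, l)) (v : 'cV[R]_l) :
  vnorm2 (M *m v) <= mxnorm2 M * vnorm2 v.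
Proof.
have [->|v0] := eqVneq v 0; first by rewrite mulmx0 !vnorm2_0 mulr0.
have v_gt0 : 0 < vnorm2 v by rewrite lt_def vnorm2_eq0 v0 vnorm2_ge0.
rewrite -ler_pdivrMr //.
have -> : vnorm2 (M *m v) / vnorm2 v = vnorm2 (M *m ((vnorm2 v)^-1 *: v)).
  by rewrite -scalemxAr vnorm2Z ger0_norm ?invr_ge0 ?vnorm2_ge0 // mulrC.
apply: ub_le_sup; first exact: mxnorm2_has_ubound.
exists ((vnorm2 v)^-1 *: v) => //=.
by rewrite vnorm2Z ger0_norm ?invr_ge0 ?vnorm2_ge0 // mulVf ?gt_eqF.
Qed.

End EuclideanNorm.


(** * Perturbation of a simple eigenvalue of a symmetric pair *)

(** Cauchy-Schwarz in the plane, a + |s| f <= sqrt (1 + s^2) sqrt (a^2 + f^2):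
    the factor sqrt (1 + s^2) cancels against the denominator of the chordal
    distance, so that only the unperturbed t survives in the bound. *)
Lemma chordal_le (R : realType) (s t a f M : R) : 0 <= M ->
  `|s - t| <= M * (a + `|s| * f) ->
  chordal s t <= M / Num.sqrt (1 + t ^+ 2) * Num.sqrt (a ^+ 2 + f ^+ 2).
Proof.
move=> M_ge0 shift.
have r_gt0 (r : R) : 0 < Num.sqrt (1 + r ^+ 2).
  by rewrite sqrtr_gt0 ltr_pwDl // sqr_ge0.
rewrite ler_pdivrMr ?mulr_gt0 //.
apply: (le_trans shift); rewrite -!mulrA ler_wpM2l //.
rewrite (mulrCA _ (Num.sqrt (1 + s ^+ 2))) (mulrC _^-1) mulrCA mulrA.
rewrite mulfK ?gt_eqF // -sqrtrM ?addr_ge0 ?sqr_ge0 //.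
apply: le_trans (ler_norm _) _; rewrite -sqrtr_sqr ler_wsqrtr //.
have := real_normK (num_real s); have := sqr_ge0 (f - a * `|s|); nra.
Qed.

Lemma near_0_mul_lt (R : realType) (P d : R) : 0 < d ->
  \forall e \near 0^'+, P * e < d.
Proof.
move=> d_gt0; near=> e.
have e_gt0 : 0 < e by near: e; exact: nbhs_right_gt.
apply: (@le_lt_trans _ _ ((`|P| + 1) * e)).
  apply: ler_wpM2r; first exact: ltW.
  by rewrite (le_trans (ler_norm P)) // lerDl.
rewrite mulrC -ltr_pdivlMr ?ltr_wpDl //; near: e.
by apply: nbhs_right_lt; rewrite divr_gt0 ?ltr_wpDl.
Unshelve. all: by end_near. Qed.

Section SimpleEigenvalue.
Variables (R : realType) (k : nat) (G H : 'M[R]_k) (sg : R) (y : 'cV[R]_k).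
Hypotheses (symG : G^T = G) (symH : H^T = H).
Hypothesis eigy : G *m y = sg *: (H *m y).
Hypothesis normy : (y^T *m (H *m y)) 0 0 = 1.
Hypothesis simpley : forall w, G *m w = sg *: (H *m w) -> exists c, w = c *: y.

Lemma left_eigenvector (w : 'cV[R]_k) :
  (y^T *m (G *m w)) 0 0 = sg * (y^T *m (H *m w)) 0 0.
Proof.
have yl (M : 'M[R]_k) : M^T = M -> (y^T *m (M *m w)) 0 0 = ((M *m y)^T *m w) 0 0.
  by move=> symM; rewrite trmx_mul symM mulmxA.
by rewrite !yl // eigy -[w in LHS]scale1r dotmxZ mulr1.
Qed.

(** N is G - sg H plus the rank one matrix (H y)(H y)^T.  Testing N v = 0
    against y gives y^T H v = 0, then (G - sg H) v = 0, so v is a multiple of y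
    and vanishes: N is invertible.  Moreover N maps w - (y^T H w) y to
    (G - sg H) w, so kappa can be the norm of the inverse of N. *)
Lemma residual_bound : exists2 kappa : R, 0 <= kappa & forall w,
  vnorm2 w <= `|(y^T *m (H *m w)) 0 0| * vnorm2 y
              + kappa * vnorm2 (G *m w - sg *: (H *m w)).
Proof.
pose N := G - sg *: H + H *m y *m (y^T *m H).
have NE w : N *m w
    = G *m w - sg *: (H *m w) + (y^T *m (H *m w)) 0 0 *: (H *m y).
  rewrite !mulmxDl mulNmx -scalemxAl -!mulmxA; congr (_ + _).
  by rewrite {1}[y^T *m _]mx11_scalar mul_mx_scalar -scalemxAr.
have Nunit : N \in unitmx.
  rewrite -unitmx_tr -row_free_unit; apply: inj_row_free => v vN0.
  have Nv : N *m v^T = 0 by rewrite -[N]trmxK -trmx_mul vN0 trmx0.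
  have c0 : (y^T *m (H *m v^T)) 0 0 = 0.
    have : (y^T *m (N *m v^T)) 0 0 = 0 by rewrite Nv mulmx0 mxE.
    rewrite NE mulmxDr mulmxBr -!scalemxAr.
    have -> (P Q S : 'M[R]_1) (a b : R) : (P - a *: Q + b *: S) 0 0
      = P 0 0 - a * Q 0 0 + b * S 0 0 by rewrite !mxE.
    by rewrite left_eigenvector subrr add0r normy mulr1.
  have : G *m v^T = sg *: (H *m v^T).
    by apply/eqP; rewrite -subr_eq0 -Nv NE c0 scale0r addr0.
  move=> /simpley[c vE]; move: c0; rewrite vE -!scalemxAr mxE normy mulr1 => c0.
  by rewrite -[v]trmxK vE c0 scale0r trmx0.
exists (mxnorm2 (invmx N)); first exact: mxnorm2_ge0.
move=> w; set c := (y^T *m (H *m w)) 0 0.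
have -> : G *m w - sg *: (H *m w) = N *m (w - c *: y).
  rewrite mulmxBr -scalemxAr !NE -/c normy eigy subrr add0r scale1r.
  by rewrite addrK.
have {1}-> : w = c *: y + invmx N *m (N *m (w - c *: y)).
  by rewrite mulKmx // addrC subrK.
apply: le_trans (vnorm2D _ _) _.
by rewrite vnorm2Z lerD2l vnorm2_mulmx.
Qed.

(** First-order perturbation identity, tested against the left eigenvector y:
    the unperturbed part G w - s H w contributes exactly
    (sg - s) (y^T H w). *)
Lemma eigenvalue_shift (E F : 'M[R]_k) (s : R) (w : 'cV[R]_k) :
  (G + E) *m w = s *: ((H + F) *m w) ->
  `|s - sg| * `|(y^T *m (H *m w)) 0 0|
    <= vnorm2 y * ((mxnorm2 E + `|s| * mxnorm2 F) * vnorm2 w).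
Proof.
move=> pert; rewrite -normrM.
have -> : (s - sg) * (y^T *m (H *m w)) 0 0
    = (y^T *m (E *m w - s *: (F *m w))) 0 0.
  rewrite mulrBl -left_eigenvector.
  have -> : E *m w = s *: ((H + F) *m w) - G *m w.
    by rewrite -pert mulmxDl addrC addKr.
  rewrite mulmxDl scalerDr addrAC addrK.
  rewrite mulmxBr -scalemxAr.
  have -> // (P Q : 'M[R]_1) (a : R) : (a *: P - Q) 0 0 = a * P 0 0 - Q 0 0.
  by rewrite !mxE.
apply: le_trans (dotmx_le _ _) _; rewrite ler_wpM2l ?vnorm2_ge0 //.
apply: le_trans (vnorm2D _ _) _; rewrite vnorm2N vnorm2Z mulrDl -mulrA.
by rewrite lerD ?ler_wpM2l ?vnorm2_mulmx.
Qed.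

Lemma perturbed_residual (E F : 'M[R]_k) (s : R) (w : 'cV[R]_k) :
  (G + E) *m w = s *: ((H + F) *m w) ->
  vnorm2 (G *m w - sg *: (H *m w))
    <= (`|s - sg| * mxnorm2 H + mxnorm2 E + `|s| * mxnorm2 F) * vnorm2 w.
Proof.
move=> pert.
have -> : G *m w - sg *: (H *m w)
    = (s - sg) *: (H *m w) + (- (E *m w) + s *: (F *m w)).
  have -> : G *m w = s *: ((H + F) *m w) - E *m w by rewrite -pert mulmxDl addrK.
  rewrite mulmxDl scalerDr scalerBl -!addrA; congr (_ + _).
  by rewrite addrC [X in X + _]addrC -addrA.
apply: le_trans (vnorm2D _ _) _; rewrite -[in leRHS]addrA [in leRHS]mulrDl.
rewrite vnorm2Z -mulrA lerD ?ler_wpM2l ?vnorm2_mulmx //.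
apply: le_trans (vnorm2D _ _) _; rewrite vnorm2N vnorm2Z mulrDl -mulrA.
by rewrite lerD ?ler_wpM2l ?vnorm2_mulmx.
Qed.

(** C depends on the pair, on y and on K, but not on the perturbation.  Two
    passes are needed: convergence of s to sg alone only makes
    |s - sg| |H| small, not O(e). *)
Lemma chordal_bound (K : R) : exists C : R,
  forall (E F : R -> 'M[R]_k) (s : R -> R) (w : R -> 'cV[R]_k),
    (\forall e \near 0^'+, eigenpair (G + E e) (H + F e) (s e) (w e)) ->
    s e @[e --> 0^'+] --> sg ->
    (\forall e \near 0^'+, mxnorm2 (E e) <= K * e) ->
    (\forall e \near 0^'+, mxnorm2 (F e) <= K * e) ->
    \forall e \near 0^'+,
      chordal (s e) sg <= vnorm2 y ^+ 2 * (1 + C * e) / Num.sqrt (1 + sg ^+ 2)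
                          * Num.sqrt (mxnorm2 (E e) ^+ 2 + mxnorm2 (F e) ^+ 2).
Proof.
have [kappa kappa_ge0 resid] := residual_bound.
pose h := mxnorm2 H; pose Y := vnorm2 y; pose T := `|sg| + 1.
have h_ge0 : 0 <= h by exact: mxnorm2_ge0.
have Y_ge0 : 0 <= Y by exact: vnorm2_ge0.
have T_ge1 : 1 <= T by rewrite /T lerDr.
pose C1 := 2 * Y ^+ 2 * ((1 + T) * K).
pose C2 := kappa * (C1 * h + (1 + T) * K).
exists (2 * C2) => E F s w eigE scvg Ebd Fbd.
(* |s - sg| below the inverse of this number makes kappa |H| |s - sg| at most
   1/4; the other 1/4 is left for the norms of E and F. *)
have kh1_gt0 : 0 < 4 * kappa * h + 4.
  by rewrite ltr_wpDl // mulr_ge0 // mulr_ge0.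
near=> e.
have e_gt0 : 0 < e by near: e; exact: nbhs_right_gt.
have [eig w_neq0] : eigenpair (G + E e) (H + F e) (s e) (w e) by near: e.
have EK : mxnorm2 (E e) <= K * e by near: e.
have FK : mxnorm2 (F e) <= K * e by near: e.
have s1 : `|sg - s e| < 1 by near: e; exact: cvgr_dist_lt.
have s2 : `|sg - s e| < (4 * kappa * h + 4)^-1.
  by near: e; apply: cvgr_dist_lt => //; rewrite invr_gt0.
have t1 : kappa * ((1 + T) * K) * e < 4^-1.
  by near: e; apply: near_0_mul_lt; rewrite invr_gt0.
have t2 : C2 * e < 2^-1 by near: e; apply: near_0_mul_lt; rewrite invr_gt0.
set a := mxnorm2 (E e) in EK *; set f := mxnorm2 (F e) in FK *.
have a_ge0 : 0 <= a by exact: mxnorm2_ge0.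
have f_ge0 : 0 <= f by exact: mxnorm2_ge0.
set c := `|(y^T *m (H *m w e)) 0 0|; set W := vnorm2 (w e).
have c_ge0 : 0 <= c by exact: normr_ge0.
have W_gt0 : 0 < W by rewrite lt_def vnorm2_eq0 w_neq0 vnorm2_ge0.
set q := a + `|s e| * f; set D := `|s e - sg|.
have D_ge0 : 0 <= D by exact: normr_ge0.
have q_ge0 : 0 <= q by rewrite addr_ge0 // mulr_ge0.
have sT : `|s e| <= T.
  rewrite -[s e](subrK sg) (le_trans (ler_normD _ _)) // addrC lerD2l distrC.
  exact: ltW.
have q_le : q <= (1 + T) * K * e.
  rewrite -mulrA mulrDl mul1r lerD //; apply: ler_pM => //.
have shift : D * c <= Y * (q * W) by exact: eigenvalue_shift.
have W_le : W <= c * Y + kappa * (D * h + q) * W.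
  apply: (le_trans (resid (w e))); rewrite lerD2l -mulrA ler_wpM2l //.
  by rewrite /q addrA; exact: perturbed_residual.
have kDh : kappa * (D * h) <= 4^-1.
  have : D * (4 * kappa * h + 4) < 1 by rewrite -ltr_pdivlMr // mul1r /D distrC.
  by move: D_ge0; nra.
(* The amplification factor is first made at most 1/2, which gives a crude
   bound on w and hence D = O(e); fed back, this makes the factor O(e). *)
have W_crude : W <= 2 * (c * Y).
  have : kappa * (D * h + q) <= 2^-1.
    have := ler_wpM2l kappa_ge0 q_le; move: kDh t1; lra.
  by move: W_le W_gt0; nra.
have c_gt0 : 0 < c.
  rewrite lt_def c_ge0 andbT; apply/eqP => c0.
  by move: W_crude; rewrite c0 mul0r mulr0 leNgt W_gt0.
have shift_le M : W <= M * c -> D <= Y * (q * M).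
  move=> WM; rewrite -(ler_pM2r c_gt0) (le_trans shift) // -!mulrA.
  by rewrite !ler_wpM2l.
have D_le : D <= C1 * e.
  have : D <= Y * (q * (2 * Y)) by apply: shift_le; rewrite -mulrA [Y * c]mulrC.
  move=> /le_trans; apply.
  rewrite /C1 (_ : _ * e = Y * ((1 + T) * K * e * (2 * Y))); last by ring.
  by rewrite ler_wpM2l // ler_wpM2r // mulr_ge0.
have eta_le : kappa * (D * h + q) <= C2 * e.
  rewrite /C2 -mulrA ler_wpM2l // mulrDl lerD //.
  by rewrite mulrAC ler_wpM2r.
have C2e_ge0 : 0 <= C2 * e.
  by apply: le_trans eta_le; rewrite mulr_ge0 // addr_ge0 // mulr_ge0.
have W_sharp : W <= Y * (1 + 2 * C2 * e) * c.
  have W1 : W * (1 - C2 * e) <= c * Y.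
    have := ler_wpM2r (ltW W_gt0) eta_le; move: W_le; lra.
  have t_ge0 : 0 <= 1 + 2 * (C2 * e) by move: C2e_ge0; lra.
  have := ler_wpM2r t_ge0 W1.
  (* (1 - t) (1 + 2 t) >= 1 when 0 <= t <= 1/2. *)
  have : 0 <= W * (C2 * e * (1 - 2 * (C2 * e))).
    by apply: mulr_ge0; [exact: ltW | apply: mulr_ge0; lra].
  by lra.
apply: chordal_le.
  by rewrite mulr_ge0 ?sqr_ge0 //; move: C2e_ge0; lra.
apply: le_trans (shift_le _ W_sharp) _.
by rewrite -/q le_eqVlt; apply/orP; left; apply/eqP; rewrite -/Y; ring.
Unshelve. all: by end_near. Qed.
End SimpleEigenvalue.


(** * Eigenvectors coming from a generalized singular value decomposition *)

Section GSVDComponent.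
Variables (R : realType) (m n p : nat).
Variables (A : 'M[R]_(m, n)) (B : 'M[R]_(p, n)).
Variables (U : 'M[R]_(m, n)) (V : 'M[R]_(p, n)) (X : 'M[R]_n).
Variables (alphas betas : 'rV[R]_n).
Hypothesis gsvdAB : is_gsvd A B U V X alphas betas.

Let al_gt0 := gsvd_alpha_gt0 gsvdAB.
Let be_gt0 := gsvd_beta_gt0 gsvdAB.

(** This exchange of roles reduces the pair (tildeB, tildeA) to the pair
    (hatA, hatB). *)
Lemma is_gsvd_swap : is_gsvd B A V U X betas alphas.
Proof.
case: gsvdAB => hA hB hU hV hX ha hb hu; split => // j.
by rewrite addrC.
Qed.

Lemma simple_gsv_swap i :
  simple_gsv alphas betas i -> simple_gsv betas alphas i.
Proof.
move=> simple j ji; apply: contra (simple j ji) => /eqP e.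
by rewrite /gsv -invf_div -[_ / betas 0 i]invf_div; apply/eqP; congr _^-1.
Qed.

Lemma gsv_gt0 j : 0 < gsv alphas betas j.
Proof. by rewrite divr_gt0. Qed.

Lemma mulmx_gsvd_col j : A *m col j X = alphas 0 j *: col j U.
Proof.
rewrite colE (gsvd_A gsvdAB) -!mulmxA mulKmx ?(gsvd_X gsvdAB) //.
have -> : diag_mx alphas *m delta_mx j 0 = alphas 0 j *: delta_mx j 0 :> 'cV_n.
  apply/matrixP => k l; rewrite mul_diag_mx !mxE.
  by have [->|] := eqVneq k j; rewrite ?mulr0.
by rewrite -scalemxAr -colE.
Qed.

(** X diagonalises A^T A by congruence since U has orthonormal columns; applied
    to (B, A) as well, it diagonalises both Gram matrices at once. *)
Lemma gram_gsvd (t : 'cV[R]_n) :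
  X^T *m (A^T *m (A *m (X *m t))) = \col_j (alphas 0 j ^+ 2 * t j 0).
Proof.
have AX : A *m X = U *m diag_mx alphas.
  by rewrite (gsvd_A gsvdAB) mulmxKV ?(gsvd_X gsvdAB).
rewrite !mulmxA -trmx_mul -mulmxA -mulmxA [A *m (X *m t)]mulmxA AX trmx_mul.
rewrite -!mulmxA [U^T *m _]mulmxA (gsvd_U gsvdAB) mul1mx tr_diag_mx.
by apply/matrixP => k l; rewrite ord1 mul_diag_mx mxE mul_diag_mx !mxE mulrA.
Qed.

Lemma gsvd_dot_col i : ((col i U)^T *m col i U) 0 0 = 1.
Proof.
have := gsvd_U gsvdAB => /matrixP/(_ i i); rewrite !mxE eqxx mulr1n => <-.
by apply: eq_bigr => k _; rewrite !mxE.
Qed.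

End GSVDComponent.

Section GSVDPair.
Variables (R : realType) (m n p : nat).
Variables (A : 'M[R]_(m, n)) (B : 'M[R]_(p, n)).
Variables (U : 'M[R]_(m, n)) (V : 'M[R]_(p, n)) (X : 'M[R]_n).
Variables (alphas betas : 'rV[R]_n) (i : 'I_n).
Hypothesis gsvdAB : is_gsvd A B U V X alphas betas.

Let gsvdBA := is_gsvd_swap gsvdAB.
Let al_gt0 := gsvd_alpha_gt0 gsvdAB.
Let be_gt0 := gsvd_beta_gt0 gsvdAB.

Local Notation sg := (gsv alphas betas i).

(** The factor 1/sqrt 2 normalises the vector for the form hatB, see
    [gsvd_eigenvector_normal]. *)
Definition gsvd_eigenvector : 'cV[R]_(m + n) :=
  (Num.sqrt 2)^-1 *: col_mx (col i U) ((betas 0 i)^-1 *: col i X).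

Lemma trmx_hatA : (hatA A)^T = hatA A.
Proof. by rewrite tr_block_mx !trmx0 trmxK. Qed.

Lemma trmx_hatB : (hatB m B)^T = hatB m B.
Proof. by rewrite tr_block_mx !trmx0 trmx1 trmx_mul trmxK. Qed.

Lemma mul_hatA (a : 'cV[R]_m) (b : 'cV[R]_n) :
  hatA A *m col_mx a b = col_mx (A *m b) (A^T *m a).
Proof. by rewrite mul_block_col !mul0mx add0r addr0. Qed.

Lemma mul_hatB (a : 'cV[R]_m) (b : 'cV[R]_n) :
  hatB m B *m col_mx a b = col_mx a (B^T *m (B *m b)).
Proof. by rewrite mul_block_col !mul0mx add0r addr0 mul1mx mulmxA. Qed.

Lemma gram_inj (a b : 'cV[R]_n) : X^T *m a = X^T *m b -> a = b.
Proof.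
have unitXT : X^T \in unitmx by rewrite unitmx_tr (gsvd_X gsvdAB).
exact: (can_inj (mulKmx unitXT)).
Qed.

Lemma trmx_mulmx_gsvd_col : A^T *m col i U
  = alphas 0 i / betas 0 i ^+ 2 *: (B^T *m (B *m col i X)).
Proof.
apply: gram_inj.
have -> : col i U = (alphas 0 i)^-1 *: (A *m col i X).
  by rewrite (mulmx_gsvd_col gsvdAB) scalerA mulVf ?scale1r ?gt_eqF.
rewrite -!scalemxAr colE (gram_gsvd gsvdAB) (gram_gsvd gsvdBA).
apply/matrixP => k l; rewrite !mxE.
have [->|] := eqVneq k i; last by rewrite !mulr0.
have := al_gt0 i; have := be_gt0 i => b0 a0.
by field; rewrite !gt_eqF.
Qed.

Lemma gsvd_eigenvectorP :
  hatA A *m gsvd_eigenvector = sg *: (hatB m B *m gsvd_eigenvector).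
Proof.
have b_neq0 : betas 0 i != 0 by rewrite gt_eqF.
rewrite /gsvd_eigenvector -!scalemxAr scalerA mulrC -scalerA; congr (_ *: _).
rewrite mul_hatA mul_hatB scale_col_mx -!scalemxAr (mulmx_gsvd_col gsvdAB).
rewrite trmx_mulmx_gsvd_col !scalerA; congr col_mx; congr (_ *: _).
  by rewrite mulrC.
by rewrite /gsv; field.
Qed.

Lemma gsvd_eigenvector_normal :
  (gsvd_eigenvector^T *m (hatB m B *m gsvd_eigenvector)) 0 0 = 1.
Proof.
rewrite /gsvd_eigenvector -scalemxAr dotmxZ mul_hatB tr_col_mx mul_row_col.
have -> (P Q : 'M[R]_1) : (P + Q) 0 0 = P 0 0 + Q 0 0 by rewrite !mxE.
rewrite (gsvd_dot_col gsvdAB) mulmxA -trmx_mul -scalemxAr.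
rewrite (mulmx_gsvd_col gsvdBA) scalerA mulVf ?gt_eqF // scale1r.
rewrite (gsvd_dot_col gsvdBA) -expr2 exprVn sqr_sqrtr //.
by rewrite mulVf.
Qed.

(** With w = (a, b) and b = X t, eliminating a leaves
    alpha_j^2 t_j = sg^2 beta_j^2 t_j for all j.  Since sg and the other
    generalized singular values are positive and distinct, only t_i survives;
    then a = A b / sg is determined by b. *)
Lemma gsvd_eigenvector_simple (w : 'cV[R]_(m + n)) :
  simple_gsv alphas betas i ->
  hatA A *m w = sg *: (hatB m B *m w) -> exists c, w = c *: gsvd_eigenvector.
Proof.
move=> simple; rewrite -[w]vsubmxK; set a := usubmx w; set b := dsubmx w.
rewrite mul_hatA mul_hatB scale_col_mx => /eq_col_mx[Ab Aa].
have sg_gt0 : 0 < sg := gsv_gt0 gsvdAB i.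
pose t := invmx X *m b.
have bE : b = X *m t by rewrite mulKVmx ?(gsvd_X gsvdAB).
move: t bE => t bE.
have t0 j : j != i -> t j 0 = 0.
  move=> /simple ji.
  have : X^T *m (A^T *m (A *m b)) = sg ^+ 2 *: (X^T *m (B^T *m (B *m b))).
    by rewrite Ab -!scalemxAr Aa -scalemxAr scalerA.
  rewrite bE (gram_gsvd gsvdAB) (gram_gsvd gsvdBA) => /matrixP/(_ j 0).
  rewrite !mxE => tj; apply/eqP; apply: contraNT ji => tj0.
  rewrite -(@eqrXn2 _ 2) ?ltW ?(gsv_gt0 gsvdAB) //.
  rewrite [gsv _ _ j]/gsv expr_div_n; apply/eqP.
  apply: (@mulIf _ (betas 0 j ^+ 2)); first by rewrite gt_eqF // exprn_gt0.
  rewrite divfK ?gt_eqF ?exprn_gt0 //.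
  by apply: (mulIf tj0); rewrite -mulrA.
have tE : t = t i 0 *: delta_mx i 0.
  apply/matrixP => j l; rewrite ord1 !mxE.
  by have [->|/t0->] := eqVneq j i; rewrite ?mulr1 ?mulr0.
have bx : b = t i 0 *: col i X by rewrite bE {1}tE -scalemxAr -colE.
exists (t i 0 * betas 0 i * Num.sqrt 2).
have s2 : Num.sqrt 2 != 0 :> R by rewrite gt_eqF // sqrtr_gt0.
have b0 : betas 0 i != 0 by rewrite gt_eqF.
rewrite /gsvd_eigenvector scalerA mulfK // scale_col_mx scalerA mulfK //.
rewrite -bx; congr col_mx; apply: (@scalerI _ _ sg); first by rewrite gt_eqF.
rewrite -Ab bx -scalemxAr (mulmx_gsvd_col gsvdAB) !scalerA; congr (_ *: _).
by rewrite /gsv; field.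
Qed.

Lemma gsvd_eigenvector_sqr : vnorm2 gsvd_eigenvector ^+ 2
  = (vnorm2 (col i X) ^+ 2 + betas 0 i ^+ 2) / (2 * betas 0 i ^+ 2).
Proof.
rewrite vnorm2Z exprMn real_normK ?num_real // exprVn sqr_sqrtr //.
rewrite [vnorm2 (col_mx _ _) ^+ 2]vnorm2_sqr tr_col_mx mul_row_col.
have -> (P Q : 'M[R]_1) : (P + Q) 0 0 = P 0 0 + Q 0 0 by rewrite !mxE.
rewrite (gsvd_dot_col gsvdAB) -vnorm2_sqr vnorm2Z exprMn.
rewrite real_normK ?num_real //.
by have := be_gt0 i => b0; field; rewrite gt_eqF.
Qed.

(** As alpha_i^2 + beta_i^2 = 1, sqrt (1 + sg^2) = 1 / beta_i, which turns
    |y|^2 / sqrt (1 + sg^2) into (|x|^2 + beta_i^2) / (2 beta_i). *)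
Lemma gsvd_chordal_bound (K : R) : simple_gsv alphas betas i ->
  exists C : R,
  forall (E F : R -> 'M[R]_(m + n)) (s : R -> R) (w : R -> 'cV[R]_(m + n)),
    (\forall e \near 0^'+, eigenpair (hatA A + E e) (hatB m B + F e) (s e) (w e)) ->
    s e @[e --> 0^'+] --> sg ->
    (\forall e \near 0^'+, mxnorm2 (E e) <= K * e) ->
    (\forall e \near 0^'+, mxnorm2 (F e) <= K * e) ->
    \forall e \near 0^'+,
      chordal (s e) sg
        <= (vnorm2 (col i X) ^+ 2 + betas 0 i ^+ 2) * (1 + C * e) / (2 * betas 0 i)
           * Num.sqrt (mxnorm2 (E e) ^+ 2 + mxnorm2 (F e) ^+ 2).
Proof.
move=> simple.
have [C bound] := chordal_bound trmx_hatA trmx_hatB gsvd_eigenvectorP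
  gsvd_eigenvector_normal (fun w => gsvd_eigenvector_simple simple) K.
exists C => E F s w eigE scvg Ebd Fbd.
apply: filterS (bound E F s w eigE scvg Ebd Fbd) => e /le_trans; apply.
have b_gt0 := be_gt0 i.
have -> : 1 + sg ^+ 2 = (betas 0 i)^-1 ^+ 2.
  rewrite /gsv expr_div_n -[1](@divff _ (betas 0 i ^+ 2)) ?gt_eqF ?exprn_gt0 //.
  by rewrite -mulrDl addrC (gsvd_unit gsvdAB) exprVn mul1r.
rewrite sqrtr_sqr gtr0_norm ?invr_gt0 // gsvd_eigenvector_sqr.
rewrite le_eqVlt; apply/orP; left; apply/eqP; congr (_ * _).
by field; rewrite gt_eqF.
Qed.

End GSVDPair.

Lemma chordalV (R : realType) (a b : R) : 0 < a -> 0 < b ->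
  chordal a^-1 b^-1 = chordal a b.
Proof.
move=> a_gt0 b_gt0; rewrite /chordal.
have sqrtV (r : R) : 0 < r ->
    Num.sqrt (1 + r^-1 ^+ 2) = Num.sqrt (1 + r ^+ 2) / r.
  move=> r_gt0; rewrite -[X in _ / X]gtr0_norm // -sqrtr_sqr.
  rewrite -sqrtrV ?sqr_ge0 // -sqrtrM ?addr_ge0 ?sqr_ge0 //.
  by congr Num.sqrt; field; rewrite gt_eqF.
rewrite !sqrtV //.
have -> : a^-1 - b^-1 = - ((a - b) / (a * b)) by field; rewrite !gt_eqF.
rewrite normrN normrM normfV [`|a * b|]gtr0_norm ?mulr_gt0 //.
have r_neq0 (r : R) : Num.sqrt (1 + r ^+ 2) != 0.
  by rewrite gt_eqF // sqrtr_gt0 ltr_pwDl // sqr_ge0.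
by field; rewrite !r_neq0 !gt_eqF.
Qed.

Lemma linear_eqO (R : realType) (C : R) :
  (fun e : R => C * e) =O_ (0^'+) (fun e : R => e).
Proof.
apply/eqO_exP; exists (`|C| + 1); first by rewrite ltr_wpDl.
near=> e; rewrite normrM ler_wpM2r // lerDl //.
Unshelve. all: by end_near. Qed.

Theorem theorem2p3 (R : realType) (m n p : nat)
  (A : 'M[R]_(m, n)) (B : 'M[R]_(p, n))
  (hmn : (n <= m)%N) (hpn : (n <= p)%N)
  (hA : \rank A = n) (hB : \rank B = n)
  (U : 'M[R]_(m, n)) (V : 'M[R]_(p, n)) (X : 'M[R]_n)
  (alphas betas : 'rV[R]_n)
  (hgsvd : is_gsvd A B U V X alphas betas)
  (i : 'I_n) (alpha beta sigma : R)
  (u : 'cV[R]_m) (v : 'cV[R]_p) (x : 'cV[R]_n)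
  (halpha : alpha = alphas 0 i) (hbeta : beta = betas 0 i)
  (hu : u = col i U) (hv : v = col i V) (hx : x = col i X)
  (hsigma : sigma = alpha / beta)
  (hsimple : simple_gsv alphas betas i)
  (y : 'cV[R]_(m + n)) (z : 'cV[R]_(p + n))
  (hy : y = (Num.sqrt 2)^-1 *: col_mx u (beta^-1 *: x))
  (hz : z = (Num.sqrt 2)^-1 *: col_mx v (alpha^-1 *: x)) :
  exists delta1 delta2 : R -> R,
    [/\ delta1 =O_ (0^'+) (fun e : R => e),
        delta2 =O_ (0^'+) (fun e : R => e) &
        forall (Ehat Fhat : R -> 'M[R]_(m + n))
               (Etilde Ftilde : R -> 'M[R]_(p + n))
               (sigmahat sigmatilde : R -> R)
               (yhat : R -> 'cV[R]_(m + n)) (ztilde : R -> 'cV[R]_(p + n)),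
          (\forall e \near 0^'+,
             eigenpair (hatA A + Ehat e) (hatB m B + Fhat e)
               (sigmahat e) (yhat e)) ->
          (\forall e \near 0^'+,
             eigenpair (tildeB B + Ftilde e) (tildeA p A + Etilde e)
               (sigmatilde e)^-1 (ztilde e)) ->
          sigmahat e @[e --> 0^'+] --> sigma ->
          (sigmatilde e)^-1 @[e --> 0^'+] --> sigma^-1 ->
          (\forall e \near 0^'+,
             Num.max (Num.max (mxnorm2 (Ehat e)) (mxnorm2 (Fhat e)))
                     (Num.max (mxnorm2 (Etilde e)) (mxnorm2 (Ftilde e)))
             <= Num.max (Num.max (mxnorm2 A ^+ 2) (mxnorm2 B ^+ 2)) 1 * e) ->
          \forall e \near 0^'+,
            chordal (sigmahat e) sigma
              <= (vnorm2 x ^+ 2 + beta ^+ 2) * (1 + delta1 e) / (2 * beta)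
                 * Num.sqrt (mxnorm2 (Ehat e) ^+ 2 + mxnorm2 (Fhat e) ^+ 2)
            /\
            chordal (sigmatilde e) sigma
              <= (vnorm2 x ^+ 2 + alpha ^+ 2) * (1 + delta2 e) / (2 * alpha)
                 * Num.sqrt (mxnorm2 (Etilde e) ^+ 2 + mxnorm2 (Ftilde e) ^+ 2)].
Proof.
pose K : R := Num.max (Num.max (mxnorm2 A ^+ 2) (mxnorm2 B ^+ 2)) 1.
have [C1 bound1] := gsvd_chordal_bound hgsvd K hsimple.
have [C2 bound2] :=
  gsvd_chordal_bound (is_gsvd_swap hgsvd) K (simple_gsv_swap hsimple).
exists (fun e => C1 * e), (fun e => C2 * e).
split; [exact: linear_eqO | exact: linear_eqO |].
move=> Eh Fh Et Ft sh st yh zt eigh eigt cvgh cvgt; rewrite -/K => bd.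
have sigmaE : gsv alphas betas i = sigma by rewrite hsigma halpha hbeta.
have sigmaVE : gsv betas alphas i = sigma^-1.
  by rewrite hsigma invf_div halpha hbeta.
have sigma_gt0 : 0 < sigma by rewrite -sigmaE (gsv_gt0 hgsvd).
rewrite sigmaE in bound1; rewrite sigmaVE in bound2.
have bd4 : \forall e \near 0^'+, [/\ mxnorm2 (Eh e) <= K * e,
    mxnorm2 (Fh e) <= K * e, mxnorm2 (Et e) <= K * e & mxnorm2 (Ft e) <= K * e].
  apply: filterS bd => e; rewrite !ge_max.
  by move=> /andP[/andP[? ?] /andP[? ?]].
have {bound1} concl1 := bound1 Eh Fh sh yh eigh cvgh
  ltac:(by apply: filterS bd4 => e []) ltac:(by apply: filterS bd4 => e []).
have {bound2} concl2 := bound2 Ft Et (fun e => (st e)^-1) zt eigt cvgt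
  ltac:(by apply: filterS bd4 => e []) ltac:(by apply: filterS bd4 => e []).
have stV_gt0 : \forall e \near 0^'+, 0 < (st e)^-1.
  by apply: cvgr_gt cvgt _ _; rewrite invr_gt0.
rewrite hx halpha hbeta; near=> e; split; first by near: e.
rewrite -chordalV //; last by rewrite -invr_gt0; near: e.
by rewrite [mxnorm2 (Et e) ^+ 2 + _]addrC; near: e.
Unshelve. all: by end_near. Qed.
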